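(* For all sums of expressions $\mathbb A,\mathbb B$ of the $\partial_0\lambda$-calculus with tests and every repetition-free list $\vec x$ of variables containing the free variables of $\mathbb A$: if $\mathbb A\twoheadrightarrow\mathbb B$ then $\llbracket\mathbb A\rrbracket_{\vec x}=\llbracket\mathbb B\rrbracket_{\vec x}$.
   Context: Syntax of the $\partial_0\lambda$-calculus with tests. Terms $M,N,L$, bags $P$ and tests $V,W$ are given by $M ::= x \mid \lambda x.M \mid MP \mid \bar\tau(V)$, $P ::= [L_1,\dots,L_k]$, $V ::= \tau[L_1,\dots,L_k]$ ($k\ge 0$), finite multisets of terms (the tag $\tau$ distinguishes tests from bags); expressions are taken up to $\alpha$-equivalence. $\uplus$ is union of bags; $\varepsilon:=\tau[\,]$ and $V\mid W$ is multiset union of tests. Sums (of each sort) are finite formal sums with idempotent addition, $0$ the empty sum; constructors extend multilinearly to sums (e.g. $\lambda x.\sum_iM_i=\sum_i\lambda x.M_i$, $(\sum_iM_i)(\sum_jP_j)=\sum_{i,j}M_iP_j$, $[\sum_iL_i]\uplus P=\sum_i[L_i]\uplus P$, $\tau[\sum_iM_i]\mid V=\sum_i\tau[M_i]\mid V$), and give $0$ when applied to $0$. $A\{0/x\}=0$ if $x$ is free in $A$, else $A$. Linear substitution: $x\langle N/x\rangle=N$; $y\langle N/x\rangle=0$ ($y\ne x$); $(\lambda y.M)\langle N/x\rangle=\lambda y.M\langle N/x\rangle$; $(MP)\langle N/x\rangle=M\langle N/x\rangle P+M(P\langle N/x\rangle)$; $\bar\tau(V)\langle N/x\rangle=\bar\tau(V\langle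 N/x\rangle)$; $[L_1,\dots,L_k]\langle N/x\rangle=\sum_i[L_1,\dots,L_i\langle N/x\rangle,\dots,L_k]$, likewise for tests. For $P=[L_1,\dots,L_k]$, $x$ not free in $P$, $A\langle P/x\rangle:=A\langle L_1/x\rangle\cdots\langle L_k/x\rangle$. Reduction: $(\lambda x.M)P\to M\langle P/x\rangle\{0/x\}$; $\bar\tau(V)P\to\bar\tau(V)$ if $P=[\,]$, else $\to0$; $\tau[\lambda x.M]\mid V\to\tau[M\{0/x\}]\mid V$; $\tau[\bar\tau(V)]\mid W\to V\mid W$; $\to$ is the closure under all syntactic positions and sums, $\twoheadrightarrow$ its reflexive-transitive closure. The model $\mathcal D$. $\mathcal M_f(S)$ = finite multisets over $S$. $D_0=\emptyset$, $D_{n+1}$ = $\mathbb N$-indexed sequences $(a_1,a_2,\dots)$ of elements of $\mathcal M_f(D_n)$ with all but finitely many empty; $\mathcal D=\bigcup_nD_n$; $a::(a_1,a_2,\dots):=(a,a_1,a_2,\dots)$; $*:=([\,],[\,],\dots)$; $\uplus$ on tuples is componentwise. For a repetition-free list $\vec x=x_1,\dots,x_n$ containing the free variables, $\llbracket M\rrbracket_{\vec x}\subseteq\mathcal M_f(\mathcal D)^n\times\mathcal D$, $\llbracket P\rrbracket_{\vec x}\subseteq\mathcal M_f(\mathcal D)^n\times\mathcal M_f(\mathcal D)$, $\llbracket V\rrbracket_{\vec x}\subseteq\mathcal M_f(\mathcal D)^n$: $\llbracket x_i\rrbracket_{\vec x}=\{(([\,],\dots,[\alpha],\dots,[\,]),\alpha):\alpha\in\mathcal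 D\}$ ($[\alpha]$ in position $i$); $\llbracket\lambda y.M\rrbracket_{\vec x}=\{(\vec a,b::\alpha):((\vec a,b),\alpha)\in\llbracket M\rrbracket_{\vec x,y}\}$; $\llbracket MP\rrbracket_{\vec x}=\{(\vec a_1\uplus\vec a_2,\alpha):\exists b\,(\vec a_1,b::\alpha)\in\llbracket M\rrbracket_{\vec x},(\vec a_2,b)\in\llbracket P\rrbracket_{\vec x}\}$; $\llbracket\bar\tau(V)\rrbracket_{\vec x}=\{(\vec a,* ):\vec a\in\llbracket V\rrbracket_{\vec x}\}$; $\llbracket[L_1,\dots,L_k]\rrbracket_{\vec x}=\{(\biguplus_i\vec a_i,[\beta_1,\dots,\beta_k]):(\vec a_i,\beta_i)\in\llbracket L_i\rrbracket_{\vec x}\}$; $\llbracket\tau[L_1,\dots,L_k]\rrbracket_{\vec x}=\{\biguplus_i\vec a_i:(\vec a_i,* )\in\llbracket L_i\rrbracket_{\vec x}\}$; a sum is interpreted as the union of the interpretations of its summands. *)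

(* Defs.v *)
From HB Require Import structures.
From Stdlib Require Import Permutation SetoidPermutation Relation_Operators.
From mathcomp Require Import all_boot finmap multiset generic_quotient.
From mathcomp Require Import boolp classical_sets.

Set Implicit Arguments.
Unset Strict Implicit.
Unset Printing Implicit Defensive.

Local Open Scope mset_scope.
Local Open Scope classical_set_scope.
Local Open Scope nat_scope.
Local Open Scope quotient_scope.

(** Alpha-equivalence is handled by de Bruijn indices: under [k] binders the
    index [k + x] is the free variable [x].  Bags and tests are both lists of
    terms; they are distinguished by the sorts introduced below, and the order
    of the lists is quotiented out by [term_eq] and [raw_eq]. *)
Inductive term : Type :=
  | Var of nat
  | Lam of term
  | App of term & seq term
  | TauBar of seq term.

HB.instance Definition _ := gen_eqMixin term.
HB.instance Definition _ := gen_choiceMixin term.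

Lemma term_nested_ind (P : term -> Prop) :
  (forall x, P (Var x)) ->
  (forall M, P M -> P (Lam M)) ->
  (forall M Q, P M -> List.Forall P Q -> P (App M Q)) ->
  (forall V, List.Forall P V -> P (TauBar V)) ->
  forall M, P M.
Proof.
move=> hV hL hA hT; fix IH 1 => -[x|M|M Q|V]; first exact: hV.
- exact: hL.
- apply: hA; first exact: IH.
  by elim: Q => [|L Q IHQ]; constructor.
- by apply: hT; elim: V => [|L V IHV]; constructor.
Qed.

(** Equality of terms as nested finite multisets. *)
Inductive term_eq : term -> term -> Prop :=
  | term_eq_var x : term_eq (Var x) (Var x)
  | term_eq_lam M M' : term_eq M M' -> term_eq (Lam M) (Lam M')
  | term_eq_app M M' P P' :
      term_eq M M' -> PermutationA term_eq P P' -> term_eq (App M P) (App M' P')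
  | term_eq_taubar V V' :
      PermutationA term_eq V V' -> term_eq (TauBar V) (TauBar V').

Lemma PermA_refl_in T (r : T -> T -> Prop) s :
  List.Forall (fun x => r x x) s -> PermutationA r s s.
Proof. by elim=> [|x {}s rx _ IHs]; constructor. Qed.

Lemma term_eq_refl M : term_eq M M.
Proof.
elim/term_nested_ind: M => [x|M IH|M P IHM IHP|V IHV]; constructor=> //;
  exact: PermA_refl_in.
Qed.

Section PermASym.
Context (T : Type) (r r' : T -> T -> Prop) (f : forall x y, r x y -> r' y x).

(* Transparent, so that it can be used in nested recursive definitions. *)
Fixpoint PermA_sym s t (p : PermutationA r s t) : PermutationA r' t s :=
  match p with
  | permA_nil => permA_nil r'
  | permA_skip x y s' t' e p' => permA_skip (f e) (PermA_sym p')
  | permA_swap x y l => permA_swap r' y x l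
  | permA_trans s' t' u p1 p2 => permA_trans (PermA_sym p2) (PermA_sym p1)
  end.

End PermASym.

Fixpoint term_eq_sym M N (e : term_eq M N) : term_eq N M :=
  match e with
  | term_eq_var x => term_eq_var x
  | term_eq_lam M N e => term_eq_lam (term_eq_sym e)
  | term_eq_app M N P Q e p =>
      term_eq_app (term_eq_sym e) (PermA_sym term_eq_sym p)
  | term_eq_taubar V W p => term_eq_taubar (PermA_sym term_eq_sym p)
  end.

Lemma term_eq_equiv : RelationClasses.Equivalence term_eq.
Proof.
split; [exact: term_eq_refl|by move=> M N; exact: term_eq_sym|].
move=> M N L e; elim: e L => [x|M1 N1 e IH|M1 N1 P1 P1' e IH eP|V V' eV] L f;
  inversion f; subst=> //; [exact/term_eq_lam/IH| |].
- by apply: term_eq_app; [exact: IH|apply: permA_trans; eauto].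
- by apply: term_eq_taubar; apply: permA_trans; eauto.
Qed.

Inductive esort := STerm | SBag | STest.

Definition raw (s : esort) : choiceType :=
  match s with STerm => term | SBag | STest => seq term end.

Definition raw_eq (s : esort) : raw s -> raw s -> Prop :=
  match s with STerm => term_eq | SBag | STest => PermutationA term_eq end.

Definition raw_eqb (s : esort) (A B : raw s) : bool := `[< raw_eq A B >].

Lemma raw_eq_equiv s : equiv_class_of (@raw_eqb s).
Proof.
have [r sy t] : RelationClasses.Equivalence (@raw_eq s).
  have := term_eq_equiv; case: s => //= e; exact: Equivalence_instance_0.
split=> [A|A B|B A C].
- by apply/asboolP; exact: r.
- by apply/asbool_equiv_eq; split; exact: sy.
- by move=> /asboolP AB /asboolP BC; apply/asboolP; exact: t BC.
Qed.

Canonical raw_equiv s := EquivRelPack (raw_eq_equiv s).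

(** Bags and tests become genuine finite multisets at every depth, and sums
    are finite sets of expressions. *)
Definition expr (s : esort) := {eq_quot (raw_equiv s)}.

Definition sums (s : esort) := {fset expr s}.

Definition cls (s : esort) (A : raw s) : expr s := \pi_(expr s) A.

Lemma cls_eq s (A B : raw s) : cls A = cls B <-> raw_eq A B.
Proof.
split=> [/eqmodP/asboolP //|e].
by apply/(@eqmodP _ (raw_equiv s))/asboolP.
Qed.

(** Finite sums of raw expressions are lists (order and repetitions being
    irrelevant once they are turned into elements of [sums]). *)
Definition to_sum (s : esort) (R : seq (raw s)) : sums s :=
  [fset cls A | A in R]%fset.

Fixpoint fv_term (M : term) : seq nat :=
  match M with
  | Var x => [:: x]
  | Lam M => [seq x.-1 | x <- fv_term M & x != 0]
  | App M P => fv_term M ++ flatten [seq fv_term L | L <- P]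
  | TauBar V => flatten [seq fv_term L | L <- V]
  end.

Definition fv_raw (s : esort) : raw s -> seq nat :=
  match s with
  | STerm => fv_term
  | SBag | STest => fun P => flatten [seq fv_term L | L <- P]
  end.

Definition fv (s : esort) (A : sums s) : seq nat :=
  flatten [seq fv_raw (repr E) | E <- enum_fset A].

Definition up_ren (f : nat -> nat) (x : nat) : nat :=
  if x is y.+1 then (f y).+1 else 0.

Fixpoint ren (f : nat -> nat) (M : term) : term :=
  match M with
  | Var x => Var (f x)
  | Lam M => Lam (ren (up_ren f) M)
  | App M P => App (ren f M) [seq ren f L | L <- P]
  | TauBar V => TauBar [seq ren f L | L <- V]
  end.

(** [lin_seq f [:: L1; ..; Lk]] is the sum over [i] of the lists
    [[:: L1; ..; f Li; ..; Lk]]. *)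
Definition lin_seq (f : term -> seq term) : seq term -> seq (seq term) :=
  fix lin s :=
    if s is L :: s' then
      [seq L' :: s' | L' <- f L] ++ [seq L :: s'' | s'' <- lin s']
    else [::].

(** [M<N/x>] *)
Fixpoint lsubst (x : nat) (N : term) (M : term) : seq term :=
  match M with
  | Var y => if y == x then [:: N] else [::]
  | Lam M => [seq Lam M' | M' <- lsubst x.+1 (ren succn N) M]
  | App M P => [seq App M' P | M' <- lsubst x N M]
               ++ [seq App M P' | P' <- lin_seq (lsubst x N) P]
  | TauBar V => [seq TauBar V' | V' <- lin_seq (lsubst x N) V]
  end.

(** [M<P/x> = M<L1/x>...<Lk/x>] *)
Definition lsubst_bag (x : nat) (P : seq term) (M : term) : seq term :=
  foldl (fun S L => flatten [seq lsubst x L M' | M' <- S]) [:: M] P.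

(** [M{0/x}] for the variable [x] of index 0 bound by the abstraction being
    opened; the surviving indices are lowered to live outside of it. *)
Definition zsubst (M : term) : seq term :=
  if 0 \in fv_term M then [::] else [:: ren predn M].

Inductive term_step : term -> seq term -> Prop :=
  | step_beta M P :
      term_step (App (Lam M) P)
        (flatten [seq zsubst M' | M' <- lsubst_bag 0 [seq ren succn L | L <- P] M])
  | step_taubar_nil V : term_step (App (TauBar V) [::]) [:: TauBar V]
  | step_taubar_cons V L P : term_step (App (TauBar V) (L :: P)) [::]
  | step_lam M S : term_step M S -> term_step (Lam M) [seq Lam M' | M' <- S]
  | step_appl M P S :
      term_step M S -> term_step (App M P) [seq App M' P | M' <- S]
  | step_appr M P S :
      bag_step P S -> term_step (App M P) [seq App M P' | P' <- S]
  | step_taubar V S :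
      test_step V S -> term_step (TauBar V) [seq TauBar V' | V' <- S]
with bag_step : seq term -> seq (seq term) -> Prop :=
  | step_bag P L Q S :
      term_step L S -> bag_step (P ++ L :: Q) [seq P ++ L' :: Q | L' <- S]
with test_step : seq term -> seq (seq term) -> Prop :=
  | step_tau_lam V M W :
      test_step (V ++ Lam M :: W) [seq V ++ M' :: W | M' <- zsubst M]
  | step_tau_taubar V U W :
      test_step (V ++ TauBar U :: W) [:: V ++ U ++ W]
  | step_test V L W S :
      term_step L S -> test_step (V ++ L :: W) [seq V ++ L' :: W | L' <- S].

Definition raw_step (s : esort) : raw s -> seq (raw s) -> Prop :=
  match s with
  | STerm => term_step
  | SBag => bag_step
  | STest => test_step
  end.

Inductive sum_step (s : esort) : sums s -> sums s -> Prop :=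
  | SumStep (A : raw s) (R : seq (raw s)) (T : sums s) :
      raw_step A R -> sum_step (cls A |` T)%fset (to_sum R `|` T)%fset.

Definition reduces (s : esort) : sums s -> sums s -> Prop :=
  clos_refl_trans (sums s) (@sum_step s).

(** [Node [:: l0; l1; ..; lk]] represents the sequence of multisets
    [(l0, l1, .., lk, [], [], ..)]. *)
Inductive tree : Type := Node of seq (seq tree).

HB.instance Definition _ := gen_eqMixin tree.
HB.instance Definition _ := gen_choiceMixin tree.

Definition children (t : tree) : seq (seq tree) := let: Node ss := t in ss.

Inductive tree_eq : tree -> tree -> Prop :=
  | tree_eq_node ss uu :
      (forall i, PermutationA tree_eq (nth [::] ss i) (nth [::] uu i)) ->
      tree_eq (Node ss) (Node uu).

Lemma tree_nested_ind (P : tree -> Prop) :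
  (forall ss, (forall i, List.Forall P (nth [::] ss i)) -> P (Node ss)) ->
  forall t, P t.
Proof.
move=> h; fix IH 1 => -[ss]; apply: h.
elim: ss => [|s ss IHss] [|i] /=; [by constructor..| |exact: IHss].
by elim: s => [|t s IHs]; constructor.
Qed.

Fixpoint tree_eq_sym t u (e : tree_eq t u) : tree_eq u t :=
  match e with
  | tree_eq_node ss uu h =>
      tree_eq_node (fun i => PermA_sym tree_eq_sym (h i))
  end.

Lemma tree_eq_rel : RelationClasses.Equivalence tree_eq.
Proof.
split; [|by move=> t u; exact: tree_eq_sym|].
- by elim/tree_nested_ind=> ss IH; constructor=> i; exact: PermA_refl_in.
- move=> t u v e; inversion e; subst=> f; inversion f; subst.
  by constructor=> i; apply: permA_trans; eauto.
Qed.

Definition tree_eqb (t u : tree) : bool := `[< tree_eq t u >].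

Lemma tree_eq_equiv : equiv_class_of tree_eqb.
Proof.
have [r sy t] := tree_eq_rel.
split=> [A|A B|B A C].
- by apply/asboolP; exact: r.
- by apply/asbool_equiv_eq; split; exact: sy.
- by move=> /asboolP AB /asboolP BC; apply/asboolP; exact: t BC.
Qed.

Canonical tree_equiv := EquivRelPack tree_eq_equiv.

Definition D := {eq_quot tree_equiv}.

Lemma pi_D_eq t u : \pi_D t = \pi_D u <-> tree_eq t u.
Proof.
split=> [/eqmodP/asboolP //|e].
by apply/(@eqmodP _ tree_equiv)/asboolP.
Qed.

(** The sequence [(a0, .., ak, [], [], ..)]. *)
Definition mkD (a : seq {mset D}) : D :=
  \pi_D (Node [seq [seq repr (b : D) | b <- enum_mset m] | m <- a]).

(** Conversely, a finite prefix of a sequence covering its nonempty components. *)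
Definition prefixD (alpha : D) : seq {mset D} :=
  [seq seq_mset [seq \pi_D t | t <- l] | l <- children (repr alpha)].

Definition coord (alpha : D) (i : nat) : {mset D} :=
  nth mset0 (prefixD alpha) i.

Definition star : D := mkD [::].

Definition dcons (a : {mset D}) (alpha : D) : D := mkD (a :: prefixD alpha).

(** [stage n] is the set [D_n]. *)
Fixpoint stage (n : nat) : set D :=
  if n is m.+1 then
    [set alpha | forall i beta, beta \in coord alpha i -> stage m beta]
  else set0.

Lemma perm_pi l l' : PermutationA tree_eq l l' ->
  perm_eq [seq \pi_D t | t <- l] [seq \pi_D t | t <- l'].
Proof.
elim=> [|x y l1 l2 exy _ IH|x y l1|l1 l2 l3 _ IH1 _ IH2] //=.
- have -> : \pi_D x = \pi_D y by exact/pi_D_eq.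
  by rewrite perm_cons.
- by rewrite (perm_catCA [:: \pi_D y] [:: \pi_D x]).
- exact: perm_trans IH1 IH2.
Qed.

Lemma pi_perm l l' :
  perm_eq [seq \pi_D t | t <- l] [seq \pi_D t | t <- l'] ->
  PermutationA tree_eq l l'.
Proof.
elim: l l' => [|x l IH] l' /=.
  by move/perm_size; case: l' => // _; constructor.
move=> h; have /mapP[y yl' exy] : \pi_D x \in [seq \pi_D t | t <- l'].
  by rewrite -(perm_mem h) mem_head.
case/splitPr: yl' h => l1 l2; rewrite map_cat /= -exy.
rewrite -[in X in perm_eq _ X]cat1s perm_sym perm_catCA /= perm_cons perm_sym.
rewrite -map_cat => /IH h.
have e := tree_eq_rel; apply: (@permA_trans _ _ _ (y :: l1 ++ l2)).
  by apply: permA_skip h; exact/pi_D_eq.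
exact: PermutationA_middle.
Qed.

Lemma coordE ss i :
  coord (\pi_D (Node ss)) i = seq_mset [seq \pi_D t | t <- nth [::] ss i].
Proof.
have nthE (uu : seq (seq tree)) :
    nth mset0 [seq seq_mset [seq \pi_D t | t <- l] | l <- uu] i
    = seq_mset [seq \pi_D t | t <- nth [::] uu i].
  have [lt|le] := ltnP i (size uu); first by rewrite (nth_map [::]).
  rewrite !nth_default ?size_map //=.
  by apply/msetP=> b; rewrite mset_seqE mset0E.
rewrite /coord /prefixD nthE.
have : tree_eq (repr (\pi_D (Node ss))) (Node ss).
  by apply/pi_D_eq; rewrite reprK.
case: (repr _) => uu e; inversion e; subst => /=.
by apply/eq_seq_msetP/perm_pi.
Qed.

(** [mkD] and [coord] identify [D] with the sequences of finite multisets over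
    [D] that are almost everywhere empty. *)
Lemma coord_mkD a i : coord (mkD a) i = nth mset0 a i.
Proof.
rewrite coordE; have [lt|le] := ltnP i (size a).
  rewrite (nth_map mset0) // -map_comp.
  rewrite (eq_map (g := id)) ?map_id ?seq_mset_id // => b /=.
  exact: reprK.
rewrite !nth_default ?size_map //=.
by apply/msetP=> b; rewrite mset_seqE mset0E.
Qed.

Lemma coord_inj alpha beta : coord alpha =1 coord beta -> alpha = beta.
Proof.
rewrite -[alpha]reprK -[beta]reprK.
case: (repr alpha) (repr beta) => ss [uu] h.
apply/pi_D_eq; constructor=> i; apply: pi_perm.
by apply/eq_seq_msetP; rewrite -!coordE.
Qed.

Lemma coord_finite alpha : exists N, forall i, N <= i -> coord alpha i = mset0.
Proof. by exists (size (prefixD alpha)) => i le; rewrite /coord nth_default. Qed.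

Lemma coord_dcons a alpha i :
  coord (dcons a alpha) i = if i is j.+1 then coord alpha j else a.
Proof. by rewrite coord_mkD; case: i. Qed.

Lemma coord_star i : coord star i = mset0.
Proof. by rewrite coord_mkD nth_nil. Qed.

(** [D] is the union of the [D_n]. *)
Lemma stage_cover alpha : exists n, stage n alpha.
Proof.
have stageS n beta : stage n beta -> stage n.+1 beta.
  elim: n beta => [//|n IH] beta h i gamma gi.
  by apply: IH; exact: h gi.
have stage_le m n beta : m <= n -> stage m beta -> stage n beta.
  by move=> /subnKC <-; elim: (n - m) => [|k IH] h;
    rewrite ?addn0 // addnS; apply: stageS; exact: IH.
rewrite -[alpha]reprK; elim/tree_nested_ind: (repr alpha) => ss IH.
have [N hN] : exists N, forall i, List.Forall (fun t => stage N (\pi_D t)) (nth [::] ss i).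
  elim: ss IH => [|s ss IHss] IH; first by exists 0 => i; rewrite nth_nil; constructor.
  have [N hN] := IHss (fun i => IH i.+1).
  have [M hM] : exists M, List.Forall (fun t => stage M (\pi_D t)) s.
    have /= hs := IH 0; elim: hs => [|t l [p hp] _ [q hq]]; first by exists 0; constructor.
    exists (maxn p q); constructor; first exact: stage_le (leq_maxl _ _) hp.
    by apply: List.Forall_impl hq => u; apply: stage_le (leq_maxr _ _).
  exists (maxn M N) => -[|i] /=.
    by apply: List.Forall_impl hM => u; apply: stage_le (leq_maxl _ _).
  by apply: List.Forall_impl (hN i) => u; apply: stage_le (leq_maxr _ _).
exists N.+1 => i beta; rewrite coordE (perm_mem (perm_eq_seq_mset _)).
case/mapP=> t ti ->; move: (hN i) => /List.Forall_forall; apply.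
by elim: (nth _ _ _) ti => //= u l IHl; rewrite inE => /orP[/eqP->|/IHl]; [left|right].
Qed.

Definition vec (n : nat) := n.-tuple {mset D}.

Definition vec0 n : vec n := [tuple mset0 | i < n].

Definition vec1 n (i : 'I_n) (alpha : D) : vec n :=
  [tuple if j == i then [mset alpha] else mset0 | j < n].

Definition vecD n (a b : vec n) : vec n :=
  [tuple (tnth a i `+` tnth b i)%mset | i < n].

(** Semantics of bags and tests from the list of the semantics of their
    elements. *)
Definition bag_den n (ds : seq (set (vec n * D))) : set (vec n * {mset D}) :=
  [set q | exists2 ps : seq (vec n * D), List.Forall2 (fun d p => d p) ds ps &
     q = (foldr (@vecD n) (vec0 n) [seq p.1 | p <- ps],
          seq_mset [seq p.2 | p <- ps])].

Definition test_den n (ds : seq (set (vec n * D))) : set (vec n) :=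
  [set a | exists2 bs : seq (vec n), List.Forall2 (fun d b => d (b, star)) ds bs &
     a = foldr (@vecD n) (vec0 n) bs].

(** Under an abstraction, the names in [xs] are shifted and the new variable 0
    is appended. *)
Fixpoint den (M : term) (n : nat) (xs : n.-tuple nat) : set (vec n * D) :=
  match M with
  | Var x => [set p | exists i alpha,
      x = tnth xs i /\ p = (vec1 i alpha, alpha)]
  | Lam M => [set p | exists a b alpha,
      den M (rcons_tuple (map_tuple succn xs) 0) (rcons_tuple a b, alpha) /\
      p = (a, dcons b alpha)]
  | App M P => [set p | exists a1 a2 b alpha,
      [/\ den M xs (a1, dcons b alpha),
          bag_den [seq den L xs | L <- P] (a2, b) &
          p = (vecD a1 a2, alpha)]]
  | TauBar V => [set p | exists2 a,
      test_den [seq den L xs | L <- V] a & p = (a, star)]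
  end.

(** The set of which interpretations are subsets. *)
Definition point (s : esort) (n : nat) : Type :=
  match s with
  | STerm => vec n * D
  | SBag => vec n * {mset D}
  | STest => vec n
  end.

Definition den_raw (s : esort) n (xs : n.-tuple nat) : raw s -> set (point s n) :=
  match s with
  | STerm => fun M => den M xs
  | SBag => fun P => bag_den [seq den L xs | L <- P]
  | STest => fun V => test_den [seq den L xs | L <- V]
  end.

Definition interp (s : esort) n (xs : n.-tuple nat) (A : sums s) :
    set (point s n) :=
  [set p | exists2 E, E \in A & den_raw xs (repr E) p].

(** The choice of representatives in [fv] and [interp] is immaterial: see
    [fv_raw_eq] and [den_raw_eq]. *)
Section PermAMap.
Context (T U : Type) (r : T -> T -> Prop) (g : T -> U).
Context (f : forall x y, r x y -> g x = g y).

Fixpoint PermA_map s t (p : PermutationA r s t) :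
    Permutation [seq g x | x <- s] [seq g x | x <- t] :=
  match p in PermutationA _ s t
    return Permutation [seq g x | x <- s] [seq g x | x <- t] with
  | permA_nil => perm_nil U
  | permA_skip x y s' t' e p' =>
      match f e in _ = z return
        Permutation (g x :: [seq g x | x <- s']) (z :: [seq g x | x <- t'])
      with erefl => perm_skip (g x) (PermA_map p') end
  | permA_swap x y l => perm_swap (g x) (g y) [seq g x | x <- l]
  | permA_trans s' t' u p1 p2 => Permutation.perm_trans (PermA_map p1) (PermA_map p2)
  end.

End PermAMap.

Lemma Permutation_seq_map T U (g : T -> U) s t : Permutation s t ->
  Permutation [seq g x | x <- s] [seq g x | x <- t].
Proof. exact: Permutation_map. Qed.

Lemma vecDCA n : left_commutative (@vecD n).
Proof.
by move=> a b c; apply: eq_from_tnth => i; rewrite !tnth_mktuple msetDCA.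
Qed.

Lemma vecD_perm n (s t : seq (vec n)) : Permutation s t ->
  foldr (@vecD n) (vec0 n) s = foldr (@vecD n) (vec0 n) t.
Proof.
by elim=> //= [x s' t' _ ->|x y l|s1 s2 s3 _ -> _ ->] //; exact: vecDCA.
Qed.

Lemma seq_mset_perm (K : choiceType) (s t : seq K) : Permutation s t ->
  seq_mset s = seq_mset t.
Proof.
elim=> //= [x s' t' _ IH|x y l|s1 s2 s3 _ -> _ ->] //; apply/eq_seq_msetP.
- by rewrite perm_cons; apply/eq_seq_msetP.
- by rewrite (perm_catCA [:: y] [:: x]).
Qed.

Lemma bag_den_perm n (ds es : seq (set (vec n * D))) :
  Permutation ds es -> bag_den ds = bag_den es.
Proof.
have sub (ds' es' : seq (set (vec n * D))) :
    Permutation ds' es' -> bag_den ds' `<=` bag_den es'.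
  move=> p q [ps h ->]; have [ps' [p' h']] := Permutation_Forall2 p h.
  apply: (ex_intro2 _ _ ps' h'); congr (_, _).
  - exact/vecD_perm/Permutation_map.
  - exact/seq_mset_perm/Permutation_map.
by move=> p; apply/seteqP; split; apply: sub => //; exact: Permutation_sym.
Qed.

Lemma test_den_perm n (ds es : seq (set (vec n * D))) :
  Permutation ds es -> test_den ds = test_den es.
Proof.
have sub (ds' es' : seq (set (vec n * D))) :
    Permutation ds' es' -> test_den ds' `<=` test_den es'.
  move=> p a [bs h ->]; have [bs' [p' h']] := Permutation_Forall2 p h.
  by apply: (ex_intro2 _ _ bs' h'); exact: vecD_perm.
by move=> p; apply/seteqP; split; apply: sub => //; exact: Permutation_sym.
Qed.

Fixpoint den_eq M N (e : term_eq M N) :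
    (fun n (xs : n.-tuple nat) => den M xs) = (fun n xs => den N xs).
Proof.
refine (match e in term_eq M N
  return (fun n (xs : n.-tuple nat) => den M xs) = (fun n xs => den N xs) with
  | term_eq_var x => erefl
  | term_eq_lam M N e => _ (den_eq _ _ e)
  | term_eq_app M N P Q e p =>
      _ (den_eq _ _ e)
        (PermA_map (g := fun M n (xs : n.-tuple nat) => den M xs) den_eq p)
  | term_eq_taubar V W p =>
      _ (PermA_map (g := fun M n (xs : n.-tuple nat) => den M xs) den_eq p)
  end) => {den_eq e}.
- move=> h; apply: functional_extensionality_dep => m; apply/funext => ys /=.
  have hM k (zs : k.-tuple nat) : den M zs = den N zs.
    exact: (congr1 (fun F => F k zs) h).
  by rewrite hM.
- move=> h hP; apply: functional_extensionality_dep => m; apply/funext => ys /=.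
  have -> : den M ys = den N ys by exact: (congr1 (fun F => F m ys) h).
  have := Permutation_seq_map (fun F => F m ys) hP; rewrite -!map_comp.
  by move/bag_den_perm => /= ->.
- move=> hP; apply: functional_extensionality_dep => m; apply/funext => ys /=.
  have := Permutation_seq_map (fun F => F m ys) hP; rewrite -!map_comp.
  by move/test_den_perm => /= ->.
Qed.

Lemma den_raw_eq s n (xs : n.-tuple nat) (A B : raw s) :
  raw_eq A B -> den_raw xs A = den_raw xs B.
Proof.
have h M N : term_eq M N -> den M xs = den N xs.
  by move=> /den_eq e; exact: (congr1 (fun F => F n xs) e).
case: s A B => /= A B.
- exact: h.
- by move=> p; exact/bag_den_perm/(PermA_map h).
- by move=> p; exact/test_den_perm/(PermA_map h).
Qed.

Lemma has_perm T (p : pred T) s t : Permutation s t -> has p s = has p t.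
Proof.
elim=> //= [x s' t' _ -> //|x y l|s1 s2 s3 _ -> _ ->] //.
by rewrite orbCA.
Qed.

Lemma mem_fv_seq x (P : seq term) :
  (x \in flatten [seq fv_term L | L <- P]) =
  has (fun p => p x) [seq (fun y => y \in fv_term L) | L <- P].
Proof. by elim: P => //= L P IH; rewrite mem_cat IH. Qed.

Fixpoint fv_eq M N (e : term_eq M N) :
  (fun x => x \in fv_term M) = (fun x => x \in fv_term N).
Proof.
refine (match e in term_eq M N
  return (fun x => x \in fv_term M) = (fun x => x \in fv_term N) with
  | term_eq_var x => erefl
  | term_eq_lam M N e => _ (fv_eq _ _ e)
  | term_eq_app M N P Q e p =>
      _ (fv_eq _ _ e) (PermA_map (g := fun M x => x \in fv_term M) fv_eq p)
  | term_eq_taubar V W p =>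
      _ (PermA_map (g := fun M x => x \in fv_term M) fv_eq p)
  end) => {fv_eq e}.
- move=> h; apply/funext => x /=.
  have hM : fv_term M =i fv_term N by move=> y; exact: (congr1 (@^~ y) h).
  by apply/eq_mem_map => y; rewrite !mem_filter hM.
- move=> h hP; apply/funext => x /=; rewrite !mem_cat !mem_fv_seq.
  by rewrite (has_perm _ hP) (congr1 (@^~ x) h : (x \in fv_term M) = _).
- by move=> hP; apply/funext => x /=; rewrite !mem_fv_seq (has_perm _ hP).
Qed.

Lemma fv_raw_eq s (A B : raw s) : raw_eq A B -> fv_raw A =i fv_raw B.
Proof.
case: s A B => /= A B e x; first exact: (congr1 (@^~ x) (fv_eq e)).
- by rewrite !mem_fv_seq (has_perm _ (PermA_map fv_eq e)).
- by rewrite !mem_fv_seq (has_perm _ (PermA_map fv_eq e)).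
Qed.

(* Main.v *)
Require Import Defs.
From mathcomp Require Import all_boot finmap.
From mathcomp Require Import boolp classical_sets.
From mathcomp Require Import multiset zify.

(** Index environments by all variables instead of by the positions of a list:
    [sem M alpha] is a set of functions from variables to finite multisets, and
    [den M xs] is its trace on the functions supported by [xs].  Each syntactic
    operation then becomes an operation on sets of environments that commutes
    with unions: juxtaposition is the convolution [conv], and linear
    substitution [M<N/x>] moves one point of the [x]-component of [M] into [N]
    ([plug]), which is a derivation with respect to [conv].  This gives an
    exact equation for every reduction step, even when free variables of the
    expression are missing from [xs]: every free occurrence uses up a point, so
    both sides are then empty. *)

Set Implicit Arguments.
Unset Strict Implicit.
Unset Printing Implicit Defensive.

Local Open Scope mset_scope.
Local Open Scope nat_scope.

(** * Environments attaching a finite multiset of points to every variable *)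

Definition ctx := nat -> {mset D}.

Definition ctx0 : ctx := fun=> mset0.
Definition ctxD (a b : ctx) : ctx := fun x => (a x `+` b x)%mset.
Definition ctx1 (x : nat) (beta : D) : ctx :=
  fun y => if y == x then [mset beta]%mset else mset0.
Definition scons (b : {mset D}) (a : ctx) : ctx :=
  fun x => if x is y.+1 then a y else b.

Implicit Types a c u v : ctx.

Lemma ctxP a (b : ctx) : a = b <-> forall x beta, a x beta = b x beta.
Proof.
split=> [-> //|h]; apply/funext => x; apply/msetP => beta; exact: h.
Qed.

Lemma ctxDE a (b : ctx) x beta : ctxD a b x beta = a x beta + b x beta.
Proof. by rewrite msetE2. Qed.

Lemma ctx0E x beta : ctx0 x beta = 0.
Proof. by rewrite mset0E. Qed.

Ltac ctx_lia :=
  let y := fresh in let d := fresh in apply/ctxP => y d;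
  repeat match goal with h : @eq ctx _ _ |- _ => move/ctxP/(_ y d): h end;
  rewrite ?ctxDE ?ctx0E; lia.

Lemma ctx1E x beta y d : ctx1 x beta y d = (y == x) && (d == beta).
Proof. by rewrite /ctx1; case: eqP => _; rewrite ?msetnE ?mset0E //; case: eqP. Qed.

Lemma ctx1_sub a x beta : 0 < a x beta -> exists u, a = ctxD u (ctx1 x beta).
Proof.
move=> h; exists (fun y => (a y `\` ctx1 x beta y)%mset).
apply/ctxP => y d; rewrite ctxDE msetE2 ctx1E.
by case: eqP => [->|_] /=; [case: eqP => [->|_]|]; rewrite ?subn0 ?addn0 // subnK.
Qed.

(** Comparing multiplicities at [x] and [beta] shows that [a1] or [a2] contains the singled-out
    point, which can then be removed from that summand. This is the combinatorial core of the
    Leibniz rule for [plug]. *)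
Lemma ctxD1_split a x beta a1 a2 : ctxD a (ctx1 x beta) = ctxD a1 a2 ->
  (exists2 u, a1 = ctxD u (ctx1 x beta) & a = ctxD u a2) \/
  (exists2 u, a2 = ctxD u (ctx1 x beta) & a = ctxD a1 u).
Proof.
move=> e; have := e => /ctxP/(_ x beta); rewrite !ctxDE ctx1E !eqxx addn1 => e1.
have [/ctx1_sub[u eu]|/ctx1_sub[u eu]] : 0 < a1 x beta \/ 0 < a2 x beta by lia.
- by left; exists u => //; ctx_lia.
- by right; exists u => //; ctx_lia.
Qed.

Lemma sconsDD (b c : {mset D}) a1 a2 :
  scons (b `+` c) (ctxD a1 a2) = ctxD (scons b a1) (scons c a2).
Proof. by apply/funext => -[|x]. Qed.

Lemma scons_inj (b c : {mset D}) a1 a2 : scons b a1 = scons c a2 -> b = c /\ a1 = a2.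
Proof.
by move=> e; split; [have := congr1 (@^~ 0) e|apply/funext => x; have := congr1 (@^~ x.+1) e].
Qed.

Lemma scons_eta a : a = scons (a 0) (fun x => a x.+1).
Proof. by apply/funext => -[]. Qed.

Lemma scons_ctx1 x beta : scons mset0 (ctx1 x beta) = ctx1 x.+1 beta.
Proof. by apply/funext => -[|y]. Qed.

Lemma scons_ctx10 beta : scons [mset beta] ctx0 = ctx1 0 beta.
Proof. by apply/funext => -[|y]. Qed.

Local Open Scope classical_set_scope.
Local Open Scope nat_scope.

(** * Convolution of sets of environments *)

Definition conv (Q R : set ctx) : set ctx :=
  [set a | exists a1 a2, [/\ a = ctxD a1 a2, Q a1 & R a2]].

Lemma convC Q R : conv Q R = conv R Q.
Proof.
by apply/seteqP; split=> a [a1 [a2 [-> h1 h2]]]; exists a2, a1; split=> //; ctx_lia.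
Qed.

Lemma convA Q R S : conv Q (conv R S) = conv (conv Q R) S.
Proof.
apply/seteqP; split=> a.
- move=> [a1 [_ [-> h1 [a2 [a3 [-> h2 h3]]]]]].
  by exists (ctxD a1 a2), a3; split=> //; [ctx_lia|exists a1, a2].
- move=> [_ [a3 [-> [a1 [a2 [-> h1 h2]]] h3]]].
  by exists a1, (ctxD a2 a3); split=> //; [ctx_lia|exists a2, a3].
Qed.

Lemma conv1 Q : conv [set ctx0] Q = Q.
Proof.
apply/seteqP; split=> a.
- by move=> [_ [a2 [-> -> h]]]; have -> : ctxD ctx0 a2 = a2 by ctx_lia.
- by move=> h; exists ctx0, a; split=> //; ctx_lia.
Qed.

Lemma convUl R : {morph conv^~ R : Q Q' / Q `|` Q'}.
Proof.
move=> Q Q'; apply/seteqP; split=> a.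
- by move=> [a1 [a2 [-> [h|h] h2]]]; [left|right]; exists a1, a2.
- by move=> [|] [a1 [a2 [-> h h2]]]; exists a1, a2; split=> //; [left|right].
Qed.

Lemma conv0l R : conv set0 R = set0.
Proof. by apply/seteqP; split=> // a [a1 [a2 []]]. Qed.

Lemma conv_suml T (S : seq T) (F : T -> set ctx) R :
  conv (\big[setU/set0]_(A <- S) F A) R = \big[setU/set0]_(A <- S) conv (F A) R.
Proof. exact: (big_morph _ (convUl R) (conv0l R)). Qed.

Lemma conv_sumr T (S : seq T) (F : T -> set ctx) R :
  conv R (\big[setU/set0]_(A <- S) F A) = \big[setU/set0]_(A <- S) conv R (F A).
Proof. by rewrite convC conv_suml; apply: eq_bigr => A _; rewrite convC. Qed.

Lemma sum_bigcup T I (S : seq T) (F : I -> T -> set ctx) :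
  \big[setU/set0]_(A <- S) (\bigcup_i F i A)
  = \bigcup_i \big[setU/set0]_(A <- S) F i A.
Proof.
elim: S => [|A S IH]; first by
  rewrite big_nil; apply/esym; rewrite -subset0 => a [i _]; rewrite big_nil.
rewrite big_cons IH; apply/seteqP; split=> a.
- by case=> -[i _ h]; exists i => //; rewrite big_cons; [left|right].
- by case=> i _; rewrite big_cons => -[h|h]; [left|right]; exists i.
Qed.

(** * Linear substitution on sets of environments *)

(** The semantics of [M<N/x>] from those of [N] and [M]. *)
Definition plug (x : nat) (N : D -> set ctx) (Q : set ctx) : set ctx :=
  [set a | exists u c beta,
     [/\ a = ctxD u c, Q (ctxD u (ctx1 x beta)) & N beta c]].

Lemma plugU x N : {morph plug x N : Q R / Q `|` R}.
Proof.
move=> Q R; apply/seteqP; split=> a.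
- by move=> [u [c [beta [-> [h|h] h2]]]]; [left|right]; exists u, c, beta.
- by move=> [|] [u [c [beta [-> h h2]]]]; exists u, c, beta; split=> //; [left|right].
Qed.

Lemma plug0 x N : plug x N set0 = set0.
Proof. by apply/seteqP; split=> // a [u [c [beta []]]]. Qed.

Lemma plug_unit x N : plug x N [set ctx0] = set0.
Proof.
apply/seteqP; split=> // a [u [c [beta [_ /ctxP/(_ x beta)]]]].
by rewrite ctxDE ctx1E !eqxx ctx0E addn1.
Qed.

Lemma plug_ctx1 x N y alpha :
  plug x N [set ctx1 y alpha] = if y == x then N alpha else set0.
Proof.
apply/seteqP; split=> a.
- move=> [u [c [beta [-> + h]]]]; rewrite -[_ _]/(_ = _ :> ctx) => e.
  (* The left side of [e] has a point [beta] at [x]. The right side has only one point in all, so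
     [y = x], [alpha = beta] and [u] is empty. *)
  have := e => /ctxP/(_ x beta); rewrite ctxDE !ctx1E !eqxx /=.
  case: eqVneq => [xy|_]; last by lia.
  case: eqVneq => [eb|_] e1; last by move: e1 => /=; lia.
  subst x beta.
  by have -> : ctxD u c = c by ctx_lia.
- case: eqVneq => // -> h; exists ctx0, a, alpha.
  by split=> //=; ctx_lia.
Qed.

Lemma plug_bigcup x N I (F : I -> set ctx) :
  plug x N (\bigcup_i F i) = \bigcup_i plug x N (F i).
Proof.
apply/seteqP; split=> a.
- by move=> [u [c [beta [-> [i _ h] h2]]]]; exists i => //; exists u, c, beta.
- by move=> [i _ [u [c [beta [-> h h2]]]]]; exists u, c, beta; split=> //; exists i.
Qed.

(* The point at [x] belongs to exactly one of the two factors: Leibniz' rule. *)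
Lemma plug_conv x N Q R :
  plug x N (conv Q R) = conv (plug x N Q) R `|` conv Q (plug x N R).
Proof.
apply/seteqP; split=> a.
- move=> [u [c [beta [-> [a1 [a2 [e h1 h2]]] h]]]].
  have [[v ev eu]|[v ev eu]] := ctxD1_split e; [left|right].
  + exists (ctxD v c), a2; split=> //; first by ctx_lia.
    by exists v, c, beta; rewrite -ev.
  + exists a1, (ctxD v c); split=> //; first by ctx_lia.
    by exists v, c, beta; rewrite -ev.
- case.
  + move=> [_ [a2 [-> [u [c [beta [-> h h']]]] h2]]].
    exists (ctxD u a2), c, beta; split=> //; first by ctx_lia.
    by exists (ctxD u (ctx1 x beta)), a2; split=> //; ctx_lia.
  + move=> [a1 [_ [-> h1 [u [c [beta [-> h h']]]]]]].
    exists (ctxD a1 u), c, beta; split=> //; first by ctx_lia.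
    by exists a1, (ctxD u (ctx1 x beta)); split=> //; ctx_lia.
Qed.

(** * Tails in [D] and the interpretation over environments *)

Definition tl (alpha : D) : D := mkD (behead (prefixD alpha)).

Lemma coord_tl alpha i : coord (tl alpha) i = coord alpha i.+1.
Proof. by rewrite coord_mkD nth_behead. Qed.

Lemma tl_dcons b alpha : tl (dcons b alpha) = alpha.
Proof. by apply: coord_inj => i; rewrite coord_tl coord_dcons. Qed.

Lemma dcons_eta alpha : dcons (coord alpha 0) (tl alpha) = alpha.
Proof. by apply: coord_inj => -[|i]; rewrite coord_dcons // coord_tl. Qed.

Lemma tl_star : tl star = star.
Proof. by apply: coord_inj => i; rewrite coord_tl !coord_star. Qed.

(** Points are paired with bag elements in list order, which allows plain induction on lists; the
    order is forgotten only in the application clause of [sem], through [seq_mset]. *)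
Fixpoint seq_sem (ds : seq (D -> set ctx)) (bs : seq D) : set ctx :=
  match ds, bs with
  | [::], [::] => [set ctx0]
  | d :: ds', beta :: bs' => conv (d beta) (seq_sem ds' bs')
  | _, _ => set0
  end.

(** Only [k = size ds] contributes, since [seq_sem] is empty when the lengths differ. Writing a test
    as a union of bag interpretations lets the results on bags apply to tests. *)
Definition test_sem (ds : seq (D -> set ctx)) : set ctx :=
  \bigcup_k seq_sem ds (nseq k star).

(** Since every point splits uniquely into head and tail, abstraction becomes a preimage.
    Application ranges over all enumerations [bs] of a multiset, so none has to be chosen. Each
    clause commutes with unions. *)
Fixpoint sem (M : term) (alpha : D) : set ctx :=
  match M with
  | Var x => [set ctx1 x alpha]
  | Lam M => scons (coord alpha 0) @^-1` sem M (tl alpha)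
  | App M P => \bigcup_bs conv (sem M (dcons (seq_mset bs) alpha))
                               (seq_sem [seq sem L | L <- P] bs)
  | TauBar V => [set a | alpha = star /\ test_sem [seq sem L | L <- V] a]
  end.

Definition sems (P : seq term) := seq_sem [seq sem L | L <- P].

Lemma test_semE ds :
  test_sem ds = foldr conv [set ctx0] [seq d star | d <- ds].
Proof.
elim: ds => [|d ds IH] /=; apply/seteqP; split=> a.
- by move=> [[|k] _].
- by move=> h; exists 0.
- by rewrite -IH => -[[//|k] _ [a1 [a2 [-> h1 h2]]]]; exists a1, a2; split=> //; exists k.
- by rewrite -IH => -[a1 [a2 [-> h1 [k _ h2]]]]; exists k.+1 => //; exists a1, a2.
Qed.

Lemma test_sem_cat ds es : test_sem (ds ++ es) = conv (test_sem ds) (test_sem es).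
Proof.
rewrite !test_semE map_cat; elim: ds => [|d ds IH] /=; first by rewrite conv1.
by rewrite IH convA.
Qed.

Lemma test_sem_cons d es : test_sem (d :: es) = conv (d star) (test_sem es).
Proof. by rewrite !test_semE. Qed.

(** * Weakening by a fresh variable *)

(* The renaming [bump k] makes room for a variable of index [k]. *)
Definition push (k : nat) (a : ctx) : ctx :=
  fun y => if y == k then mset0 else a (unbump k y).

Lemma push0 a : push 0 a = scons mset0 a.
Proof. by apply/funext => -[|y] //; rewrite /push /= /unbump subn1. Qed.

Lemma pushS k b a : push k.+1 (scons b a) = scons b (push k a).
Proof.
apply/funext => -[|y] //; rewrite /push /= eqSS; case: eqVneq => // ne.
by rewrite /unbump ltnS; case: y ne => [|y] ne; case: ltnP; rewrite ?subn1 ?subn0.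
Qed.

Lemma pushD k a (b : ctx) : push k (ctxD a b) = ctxD (push k a) (push k b).
Proof.
by apply/funext => y; rewrite /push /ctxD; case: eqP => // _; rewrite msetD0.
Qed.

Lemma push_ctx0 k : push k ctx0 = ctx0.
Proof. by apply/funext => y; rewrite /push; case: eqP. Qed.

Lemma push_ctx1 k x alpha : push k (ctx1 x alpha) = ctx1 (bump k x) alpha.
Proof.
apply/funext => y; rewrite /push /ctx1; case: eqVneq => [->|ne].
  by rewrite (negPf (neq_bump _ _)).
congr (if _ then _ else _); apply/eqP/eqP => [<-|->]; last exact: bumpK.
by rewrite unbumpKcond (negPf ne).
Qed.

Lemma up_ren_bump k : up_ren (bump k) = bump k.+1.
Proof. by apply/funext => -[|x] //=; rewrite bumpS. Qed.

Lemma image_conv k Q R : push k @` conv Q R = conv (push k @` Q) (push k @` R).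
Proof.
apply/seteqP; split=> a.
- move=> [_ [a1 [a2 [-> h1 h2]]] <-]; rewrite pushD.
  by exists (push k a1), (push k a2); split; [|exists a1|exists a2].
- move=> [_ [_ [-> [a1 h1 <-] [a2 h2 <-]]]]; rewrite -pushD.
  by exists (ctxD a1 a2) => //; exists a1, a2.
Qed.

Lemma seq_sem_ren k P bs :
  List.Forall (fun L => forall beta, sem (ren (bump k) L) beta = push k @` sem L beta) P ->
  sems [seq ren (bump k) L | L <- P] bs = push k @` sems P bs.
Proof.
rewrite /sems => h; elim: h bs => [|L {}P hL _ IH] [|beta bs] //=; rewrite ?image_set0 //.
  by rewrite image_set1 push_ctx0.
by rewrite IH hL image_conv.
Qed.

(** Only [k = 0] is needed for shifts, but crossing a binder turns [bump k] into [bump k.+1], so the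
    induction is over all [k]. *)
Lemma sem_ren k M alpha : sem (ren (bump k) M) alpha = push k @` sem M alpha.
Proof.
elim/term_nested_ind: M k alpha => [x|M IH|M P IHM IHP|V IHV] k alpha /=.
- by rewrite image_set1 push_ctx1.
- rewrite up_ren_bump IH; apply/seteqP; split=> a.
  + move=> [a' h]; rewrite [a']scons_eta pushS => /scons_inj[e <-].
    by exists (fun x => a' x.+1) => //=; rewrite -e -scons_eta.
  + by move=> [a' h <-]; exists (scons (coord alpha 0) a') => //; rewrite pushS.
- rewrite image_bigcup; apply: eq_bigcupr => bs _; rewrite image_conv IHM.
  congr conv; apply: seq_sem_ren; exact: List.Forall_impl IHP.
- have e j : sems [seq ren (bump k) L | L <- V] (nseq j star) = push k @` sems V (nseq j star).
    by apply: seq_sem_ren; apply: List.Forall_impl IHV.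
  apply/seteqP; split=> a.
  + by move=> [-> [j _]]; rewrite -/(sems _) e => -[a' h <-]; exists a' => //; split=> //; exists j.
  + move=> [a' [-> [j _ h]] <-]; split=> //; exists j => //.
    by rewrite -/(sems _) e; exists a'.
Qed.

Lemma sem_shift M alpha : sem (ren succn M) alpha = scons mset0 @` sem M alpha.
Proof.
by rewrite (_ : succn = bump 0) ?sem_ren; [congr image; apply/funext => a; rewrite push0|].
Qed.

(** * Free variables and the substitution of 0 *)

Lemma ren_cancel f g M : {in fv_term M, cancel g f} -> ren f (ren g M) = M.
Proof.
elim/term_nested_ind: M f g => [x|M IH|M P IHM IHP|V IHV] f g h /=.
- by rewrite h ?inE.
- rewrite IH // => -[|x] hx //=; rewrite h //.
  by apply/mapP; exists x.+1 => //; rewrite mem_filter.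
- rewrite IHM; last by move=> x hx; apply: h; rewrite /= mem_cat hx.
  congr App; have {h} : {in flatten [seq fv_term L | L <- P], cancel g f}.
    by move=> x hx; apply: h; rewrite /= mem_cat hx orbT.
  elim: IHP => //= L {}P IHL _ IHP h.
  rewrite IHL ?IHP // => x hx; apply: h; rewrite mem_cat hx ?orbT //.
- congr TauBar; move: h => /=.
  elim: IHV => //= L {}V IHL _ IHV h.
  rewrite IHL ?IHV // => x hx; apply: h; rewrite mem_cat hx ?orbT //.
Qed.

(** Linearity: each element of a bag is used exactly once, so a free occurrence of [x] always
    contributes a point at [x], and sums of multisets never cancel. *)
Lemma sem_fv M alpha x a : x \in fv_term M -> sem M alpha a -> a x <> mset0.
Proof.
have nz (u v : ctx) y : u y <> mset0 \/ v y <> mset0 -> ctxD u v y <> mset0.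
  move=> h e; have h0 beta : u y beta = 0 /\ v y beta = 0.
    by have := congr1 (fun m : {mset D} => m beta) e; rewrite ctxDE mset0E; lia.
  by case: h; apply; apply/msetP => beta; rewrite mset0E; case: (h0 beta).
have sq (P : seq term) y bs (c : ctx) : List.Forall (fun L => forall beta z b,
    z \in fv_term L -> sem L beta b -> b z <> mset0) P ->
    y \in flatten [seq fv_term L | L <- P] -> sems P bs c -> c y <> mset0.
  rewrite /sems => h; elim: h bs c => [//|L {}P hL _ IH] [//|beta bs] c /=.
  rewrite mem_cat => hy [a1 [a2 [-> h1 h2]]]; apply: nz.
  by case/orP: hy => hy; [left; exact: hL h1|right; exact: IH h2].
elim/term_nested_ind: M alpha x a => [y|M IH|M P IHM IHP|V IHV] alpha x a /=.
- rewrite inE => /eqP <- -> /(congr1 (fun m : {mset D} => m alpha)).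
  by rewrite ctx1E !eqxx mset0E.
- case/mapP=> -[|y]; rewrite mem_filter //= => hy -> h.
  exact: (IH _ _ _ hy h).
- rewrite mem_cat => hx [bs _ [a1 [a2 [-> h1 h2]]]]; apply: nz.
  by case/orP: hx => hx; [left; exact: IHM h1|right; exact: sq h2].
- by move=> hx [_ [k _]]; exact: sq.
Qed.

(** If 0 is free in [M], the left side is an empty sum and the right side is empty by [sem_fv].
    Otherwise [M] is the shift of its lowered form, and [sem_shift] applies. *)
Lemma sem_zsubst M alpha :
  \big[setU/set0]_(M' <- zsubst M) sem M' alpha = scons mset0 @^-1` sem M alpha.
Proof.
rewrite /zsubst; case: ifPn => h.
  rewrite big_nil; apply/seteqP; split=> // a /= /(sem_fv h); exact.
(* [succn] undoes [predn] except at 0, which is not free in [M] here. *)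
rewrite big_seq1 -[in RHS](@ren_cancel succn predn M); last first.
  by move=> [|x] //; rewrite (negPf h).
rewrite sem_shift; apply/seteqP; split=> a; first by exists a.
by move=> [a' ha /scons_inj[_ <-]].
Qed.

(** * Linear substitution of terms *)

Lemma sem_lin_seq (f : term -> seq term) x N P bs :
  List.Forall (fun L => forall beta,
    \big[setU/set0]_(L' <- f L) sem L' beta = plug x N (sem L beta)) P ->
  \big[setU/set0]_(P' <- lin_seq f P) sems P' bs = plug x N (sems P bs).
Proof.
rewrite /sems => h; elim: h bs => [|L {}P hL _ IH] bs /=.
  by rewrite big_nil; case: bs => [|beta bs]; rewrite ?plug_unit ?plug0.
rewrite big_cat !big_map /=; case: bs => [|beta bs] /=.
  by rewrite !big1 // ?setU0 ?plug0.
by rewrite plug_conv -IH -hL conv_suml conv_sumr.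
Qed.

(** The shifted [N] has nothing at the bound variable 0, so the whole component [b] there comes from
    the body and plugging at [x.+1] leaves it unchanged. *)
Lemma plug_lam x N b Q :
  scons b @^-1` plug x.+1 (fun beta => scons mset0 @` N beta) Q
  = plug x N (scons b @^-1` Q).
Proof.
apply/seteqP; split=> a /=.
- move=> [u [c' [beta [e' h [c hc ec]]]]]; move: e'.
  rewrite -ec [u]scons_eta -sconsDD msetD0 => /scons_inj[-> ->].
  exists (fun y => u y.+1), c, beta; split=> //=.
  by rewrite -[X in scons X]msetD0 sconsDD scons_ctx1 -scons_eta.
- move=> [u [c [beta [-> h hc]]]].
  exists (scons b u), (scons mset0 c), beta; split; last by exists c.
  + by rewrite -sconsDD msetD0.
  + by rewrite -scons_ctx1 -sconsDD msetD0.
Qed.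

Lemma preimage_sum T (S : seq T) (F : T -> set ctx) b :
  scons b @^-1` (\big[setU/set0]_(A <- S) F A)
  = \big[setU/set0]_(A <- S) (scons b @^-1` F A).
Proof. exact: (big_morph (preimage (scons b)) (preimage_setU _) (preimage_set0 _)). Qed.

Lemma sem_lsubst x N M alpha :
  \big[setU/set0]_(M' <- lsubst x N M) sem M' alpha = plug x (sem N) (sem M alpha).
Proof.
elim/term_nested_ind: M x N alpha => [y|M IH|M P IHM IHP|V IHV] x N alpha /=.
- by rewrite plug_ctx1; case: eqP => _; rewrite ?big_seq1 ?big_nil.
- rewrite big_map /= -preimage_sum IH -plug_lam; congr (_ @^-1` plug _ _ _).
  by apply/funext => beta; rewrite sem_shift.
- rewrite big_cat !big_map /= !sum_bigcup plug_bigcup -bigcupU.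
  apply: eq_bigcupr => bs _; rewrite plug_conv -conv_suml -conv_sumr IHM; congr (_ `|` conv _ _).
  by apply: sem_lin_seq; apply: List.Forall_impl IHP.
- rewrite big_map /=.
  have e k := @sem_lin_seq (lsubst x N) x (sem N) V (nseq k star).
  (* Away from [star], both sides are empty. *)
  have [->|ne] := eqVneq alpha star; last first.
    rewrite big1; last by move=> V' _; rewrite -subset0 => a [/eqP]; rewrite (negPf ne).
    by apply/esym; rewrite -subset0 => a [u [c [beta [_ [/eqP]]]]]; rewrite (negPf ne).
  have tE W : [set a | star = star /\ test_sem [seq sem L | L <- W] a]
      = \bigcup_k sems W (nseq k star).
    by apply/seteqP; split=> a => [[]|].
  under eq_bigr do rewrite tE.
  rewrite tE sum_bigcup plug_bigcup; apply: eq_bigcupr => k _; apply: e.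
  by apply: List.Forall_impl IHV.
Qed.

(** * Iterated linear substitution and the beta rule *)

Definition plug_bag (x : nat) (P : seq term) (Q : set ctx) : set ctx :=
  foldl (fun Q L => plug x (sem L) Q) Q P.

Lemma plug_sum x N T (S : seq T) (F : T -> set ctx) :
  plug x N (\big[setU/set0]_(A <- S) F A) = \big[setU/set0]_(A <- S) plug x N (F A).
Proof. exact: (big_morph _ (plugU x N) (plug0 x N)). Qed.

Lemma sem_lsubst_bag x P M alpha :
  \big[setU/set0]_(M' <- lsubst_bag x P M) sem M' alpha
  = plug_bag x P (sem M alpha).
Proof.
(* Viewing [M] as a one-term sum lets the induction on [P] run over arbitrary starting sums. *)
rewrite /lsubst_bag /plug_bag -[in RHS](big_seq1 setU M (sem^~ alpha)).
elim: P [:: M] => //= L P IH S; rewrite IH; congr foldl.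
by rewrite big_flatten big_map plug_sum; apply: eq_bigr => M' _; exact: sem_lsubst.
Qed.

Lemma seq_mset_cons (beta : D) bs : seq_mset (beta :: bs) = ([mset beta] `+` seq_mset bs)%mset.
Proof. by apply/msetP => d; rewrite mset1DE !mset_seqE /= eq_sym. Qed.

(** The shifted [N] adds nothing at 0, so if [m] remains there after plugging, the component before
    it was [m] together with the consumed point [beta]. *)
Lemma plug_shift (m : {mset D}) N Q :
  scons m @^-1` plug 0 (fun beta => scons mset0 @` N beta) Q
  = \bigcup_beta conv (scons ([mset beta] `+` m)%mset @^-1` Q) (N beta).
Proof.
have e u beta : ctxD (scons m u) (ctx1 0 beta) = scons ([mset beta] `+` m)%mset u.
  by rewrite -scons_ctx10 -sconsDD msetDC; congr scons; ctx_lia.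
apply/seteqP; split=> a /=.
- move=> [u [c' [beta [e' h [c hc ec]]]]]; move: e'.
  rewrite -ec [u]scons_eta -sconsDD msetD0 => /scons_inj[em ->].
  exists beta => //; exists (fun y => u y.+1), c; split=> //=.
  by rewrite -e em -scons_eta.
- move=> [beta _ [u [c [-> h hc]]]].
  exists (scons m u), (scons mset0 c), beta; split; last by exists c.
  + by rewrite -sconsDD msetD0.
  + by rewrite e.
Qed.

(** Nothing is left at 0 after all the plugs, so the original component at 0 consists of exactly one
    consumed point per element of [P]. The list [bs] records these points in order; this is the
    matching between argument and bag in the application clause of [sem]. *)
Lemma plug_bag_shift P (Q : set ctx) :
  scons mset0 @^-1` plug_bag 0 [seq ren succn L | L <- P] Q
  = \bigcup_bs conv (scons (seq_mset bs) @^-1` Q) (sems P bs).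
Proof.
rewrite /plug_bag /sems; elim: P Q => [|L P IH] Q /=.
  apply/seteqP; split=> a.
    move=> h; exists [::] => //; rewrite convC conv1 /=.
    by rewrite (_ : seq_mset [::] = mset0) //; apply/msetP => d; rewrite mset_seqE mset0E.
  move=> [[|beta bs] _]; last by rewrite convC conv0l.
  rewrite convC conv1 /= (_ : seq_mset [::] = mset0) //.
  by apply/msetP => d; rewrite mset_seqE mset0E.
rewrite IH; have -> : sem (ren succn L) = fun beta => scons mset0 @` sem L beta.
  by apply/funext => beta; rewrite sem_shift.
apply/seteqP; split=> a.
- move=> [bs _]; rewrite plug_shift => -[_ [c [-> [beta _ [u [v [-> hu hv]]]] hc]]].
  exists (beta :: bs) => //; exists u, (ctxD v c); split; first by ctx_lia.
    by rewrite seq_mset_cons.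
  by exists v, c.
- move=> [[|beta bs] _ [u [c [-> hu]]]] //= [v [w [-> hv hw]]].
  exists bs => //; exists (ctxD u v), w; split=> //; first by ctx_lia.
  rewrite plug_shift; exists beta => //; exists u, v; split=> //=.
  by rewrite -seq_mset_cons.
Qed.

Lemma sem_beta M P alpha :
  sem (App (Lam M) P) alpha =
  \big[setU/set0]_(N <- flatten [seq zsubst M' | M' <-
     lsubst_bag 0 [seq ren succn L | L <- P] M]) sem N alpha.
Proof.
rewrite big_flatten big_map.
under eq_bigr do rewrite sem_zsubst.
rewrite -preimage_sum sem_lsubst_bag plug_bag_shift /=.
by apply: eq_bigcupr => bs _; rewrite coord_dcons tl_dcons.
Qed.

(** * Invariance under each reduction step *)

Lemma sems_context P L Q (S : seq term) bs :
  (forall beta, sem L beta = \big[setU/set0]_(L' <- S) sem L' beta) ->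
  sems (P ++ L :: Q) bs = \big[setU/set0]_(R <- [seq P ++ L' :: Q | L' <- S]) sems R bs.
Proof.
rewrite /sems big_map => h; elim: P bs => [|K P IH] [|beta bs] /=.
- by rewrite big1.
- by rewrite h conv_suml.
- by rewrite big1.
- by rewrite IH conv_sumr.
Qed.

Definition tests (V : seq term) := test_sem [seq sem L | L <- V].

Lemma tests_cat V W : tests (V ++ W) = conv (tests V) (tests W).
Proof. by rewrite /tests map_cat test_sem_cat. Qed.

Lemma tests_cons L W : tests (L :: W) = conv (sem L star) (tests W).
Proof. exact: test_sem_cons. Qed.

Lemma tests_context V L W (S : seq term) :
  sem L star = \big[setU/set0]_(L' <- S) sem L' star ->
  tests (V ++ L :: W) = \big[setU/set0]_(R <- [seq V ++ L' :: W | L' <- S]) tests R.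
Proof.
move=> h; rewrite tests_cat tests_cons h conv_suml conv_sumr big_map.
by apply: eq_bigr => L' _; rewrite tests_cat tests_cons.
Qed.

Lemma sem_taubar V alpha :
  sem (TauBar V) alpha = [set a | alpha = star /\ tests V a].
Proof. by []. Qed.

Scheme term_step_mut := Minimality for term_step Sort Prop
  with bag_step_mut := Minimality for bag_step Sort Prop
  with test_step_mut := Minimality for test_step Sort Prop.
Combined Scheme step_mut from term_step_mut, bag_step_mut, test_step_mut.

(** The closure rules hold because every constructor acts on interpretations by operations that
    commute with unions; the base rules are [sem_beta], [sem_zsubst] and direct computations with
    [star]. *)
Lemma sem_step :
  (forall M S, term_step M S ->
     forall alpha, sem M alpha = \big[setU/set0]_(M' <- S) sem M' alpha) /\
  (forall P S, bag_step P S ->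
     forall bs, sems P bs = \big[setU/set0]_(P' <- S) sems P' bs) /\
  (forall V S, test_step V S ->
     tests V = \big[setU/set0]_(V' <- S) tests V').
Proof.
apply: step_mut => [M P|V|V L P|M S _ IH|M P S _ IH|M P S _ IH|V S _ IH|P L Q S _ IH
  |V M W|V U W|V L W S _ IH].
- exact: sem_beta.
- move=> alpha; rewrite big_seq1 !sem_taubar; apply/seteqP; split=> a.
  (* Taking tails in [dcons mset0 alpha = star] gives [alpha = star]; the converse direction checks
     this equation coordinatewise. *)
  + move=> [[|beta bs] _ [b [c [-> [e hb] hc]]]] //; move: e hc => + ->.
    move=> /(congr1 tl); rewrite tl_dcons tl_star => ->.
    by have -> : ctxD b ctx0 = b by ctx_lia.
  + move=> [-> h]; exists [::] => //; rewrite convC conv1; split=> //.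
    apply: coord_inj => -[|i]; rewrite coord_dcons !coord_star //.
    by apply/msetP => d; rewrite mset_seqE mset0E.
(* A nonempty bag would require [star] to have [beta] in its first component, which is empty. *)
- move=> alpha; rewrite big_nil -subset0 => a [[|beta bs] _ [b [c [_ [+ _] //]]]].
  move=> /(congr1 (fun x => coord x 0)); rewrite coord_dcons coord_star.
  by move/msetP/(_ beta); rewrite mset_seqE mset0E /= eqxx.
- by move=> alpha; rewrite big_map /= IH preimage_sum.
- move=> alpha; rewrite big_map /= sum_bigcup; apply: eq_bigcupr => bs _.
  by rewrite IH conv_suml.
- move=> alpha; rewrite big_map /= sum_bigcup; apply: eq_bigcupr => bs _.
  by rewrite -/(sems P bs) IH conv_sumr.
- move=> alpha; rewrite big_map; under eq_bigr do rewrite sem_taubar.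
  rewrite sem_taubar IH; have [->|ne] := eqVneq alpha star.
    have e (Q : set ctx) : [set a | star = star /\ Q a] = Q by apply/seteqP; split=> a => [[]|].
    by rewrite e; under [RHS]eq_bigr do rewrite e.
  have e (Q : set ctx) : [set a | alpha = star /\ Q a] = set0.
    by rewrite -subset0 => a [/eqP]; rewrite (negPf ne).
  by rewrite e big1.
- by move=> bs; apply: sems_context.
(* Head and tail of [star] are [mset0] and [star], so the abstraction clause at [star] is exactly
   the preimage describing [zsubst]. *)
- apply: tests_context; rewrite sem_zsubst /= tl_star.
  by rewrite coord_star.
- rewrite big_seq1 !tests_cat tests_cons; congr (conv _ (conv _ _)).
  by rewrite sem_taubar; apply/seteqP; split=> a => [[]|].
- exact: tests_context.
Qed.

(** * From tuples of multisets to environments *)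

(* Variables outside of [xs] have index [size xs] and get the default [mset0]. *)
Definition env (xs : seq nat) (a : seq {mset D}) : ctx :=
  fun x => nth mset0 a (index x xs).

Section Env.
Context (n : nat) (xs : n.-tuple nat) (uniq_xs : uniq xs).

Lemma env_tnth (a : vec n) i : env xs a (tnth xs i) = tnth a i.
Proof. by rewrite /env (tnth_nth 0) index_uniq ?size_tuple // -tnth_nth. Qed.

Lemma env_out (a : vec n) x : x \notin xs -> env xs a x = mset0.
Proof. by move=> h; rewrite /env nth_default // memNindex // !size_tuple. Qed.

Lemma envP (a : vec n) f : env xs a = f <->
  (forall i, f (tnth xs i) = tnth a i) /\ forall x, x \notin xs -> f x = mset0.
Proof.
split=> [<-|[h1 h2]]; first by split=> [i|x]; [exact: env_tnth|exact: env_out].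
apply/funext => x; have [/tnthP[i ->]|h] := boolP (x \in xs).
  by rewrite env_tnth h1.
by rewrite env_out // h2.
Qed.

Lemma env_inj (a b : vec n) : env xs a = env xs b -> a = b.
Proof. by move=> e; apply: eq_from_tnth => i; rewrite -!env_tnth e. Qed.

Lemma env0 : env xs (vec0 n) = ctx0.
Proof. by apply/envP; split=> // i; rewrite tnth_mktuple. Qed.

Lemma env1 i alpha : env xs (vec1 i alpha) = ctx1 (tnth xs i) alpha.
Proof.
apply/envP; split=> [j|x h]; rewrite /ctx1.
  by rewrite tnth_mktuple (inj_eq (tuple_uniqP _ uniq_xs)).
by case: eqP h => // ->; rewrite mem_tnth.
Qed.

Lemma envD (a b : vec n) : env xs (vecD a b) = ctxD (env xs a) (env xs b).
Proof.
apply/envP; split=> [i|x h]; rewrite /ctxD.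
  by rewrite tnth_mktuple !env_tnth.
by rewrite !env_out // msetD0.
Qed.

(** A sum of multisets is empty only if both summands are, so [f1] and [f2] vanish outside [xs] and
    are determined by their values on [xs]. *)
Lemma env_split (a : vec n) f1 f2 : env xs a = ctxD f1 f2 ->
  exists a1 a2 : vec n, [/\ a = vecD a1 a2, f1 = env xs a1 & f2 = env xs a2].
Proof.
move=> e; pose r (f : ctx) : vec n := [tuple f (tnth xs i) | i < n].
have out x : x \notin xs -> f1 x = mset0 /\ f2 x = mset0.
  move=> h; have e0 d : f1 x d = 0 /\ f2 x d = 0.
    by have := e => /ctxP/(_ x d); rewrite env_out // ctxDE mset0E; lia.
  by split; apply/msetP => d; rewrite mset0E; case: (e0 d).
have e1 : env xs (r f1) = f1.
  by apply/envP; split=> [i|x /out[]//]; rewrite tnth_mktuple.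
have e2 : env xs (r f2) = f2.
  by apply/envP; split=> [i|x /out[]//]; rewrite tnth_mktuple.
by exists (r f1), (r f2); split=> //; apply: env_inj; rewrite envD e1 e2.
Qed.

Lemma conv_env (Q R : set ctx) (a : vec n) : conv Q R (env xs a) <->
  exists a1 a2 : vec n, [/\ a = vecD a1 a2, Q (env xs a1) & R (env xs a2)].
Proof.
split=> [[f1 [f2 [e h1 h2]]]|[a1 [a2 [-> h1 h2]]]].
  by have [a1 [a2 [ea e1 e2]]] := env_split e; exists a1, a2; rewrite -e1 -e2.
by exists (env xs a1), (env xs a2); rewrite envD.
Qed.

Lemma env_rcons (a : vec n) b :
  env (rcons_tuple (map_tuple succn xs) 0) (rcons_tuple a b) = scons b (env xs a).
Proof.
apply/funext => -[|x]; rewrite /env /= -!cats1 index_cat nth_cat.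
  have /negPf-> : 0 \notin [seq y.+1 | y <- xs] by apply/mapP => -[].
  by rewrite size_map !size_tuple /= addn0 ltnn subnn.
rewrite mem_map; last exact: succn_inj.
have [h|h] := boolP (x \in xs).
  rewrite index_map; last exact: succn_inj.
  by rewrite size_tuple -[X in _ < X](size_tuple xs) index_mem h.
(* A missing name gets index [n + 1] in the extended list, one past the position of [b], hence the
   default [mset0]. *)
rewrite size_map !size_tuple /= ltnNge leq_addr /= addKn /=.
by rewrite nth_default // memNindex // !size_tuple.
Qed.

Lemma bag_den_sems P (a : vec n) b :
  List.Forall (fun L => forall p, den L xs p <-> sem L p.2 (env xs p.1)) P ->
  bag_den [seq den L xs | L <- P] (a, b) <->
  exists2 bs, b = seq_mset bs & sems P bs (env xs a).
Proof.
(* The induction needs the list of points itself; it is turned into a multiset only at the end. *)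
move=> hP; suff h bs : (exists2 ps, List.Forall2 (fun d p => d p) [seq den L xs | L <- P] ps &
    a = foldr (@vecD n) (vec0 n) [seq p.1 | p <- ps] /\ bs = [seq p.2 | p <- ps])
    <-> sems P bs (env xs a).
  split=> [[ps hps [ea eb]]|[bs -> /h[ps hps [-> ->]]]]; last by exists ps.
  by exists [seq p.2 | p <- ps] => //; apply/h; exists ps.
elim: hP a bs {b} => [|L {}P hL _ IH] a bs.
  split=> [[ps hps [-> ->]]|]; first by inversion hps; subst; rewrite env0.
  by case: bs => // ea; exists [::]; [constructor|split=> //; apply: env_inj; rewrite env0].
split=> [[qs hps [-> ->]]|].
  inversion hps as [|d p ds ps hp hps']; subst => /=; rewrite envD.
  exists (env xs p.1), (env xs (foldr (@vecD n) (vec0 n) [seq p.1 | p <- ps])).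
  by split=> //; [exact/hL|apply/IH; exists ps].
case: bs => // beta bs /conv_env[a1 [a2 [-> h1 /IH[ps hps [-> ->]]]]].
exists ((a1, beta) :: ps) => //.
by apply: List.Forall2_cons hps; apply/hL.
Qed.

Lemma test_den_tests V (a : vec n) :
  List.Forall (fun L => forall p, den L xs p <-> sem L p.2 (env xs p.1)) V ->
  test_den [seq den L xs | L <- V] a <-> tests V (env xs a).
Proof.
rewrite /tests => hV; elim: hV a => [|L {}V hL _ IH] a.
  rewrite test_semE /=; split=> [[bs hbs ->]|ea].
    by inversion hbs; subst; rewrite env0.
  by exists [::]; [constructor|apply: env_inj; rewrite env0].
rewrite -/(tests _) tests_cons conv_env; split=> [[cs hbs ->]|].
  inversion hbs as [|d b ds bs hb hbs']; subst => /=.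
  exists b, (foldr (@vecD n) (vec0 n) bs); split=> //; first exact/(hL (b, star)).
  by apply/IH; exists bs.
move=> [a1 [a2 [-> h1 /IH[bs hbs ->]]]].
exists (a1 :: bs) => //.
by apply: List.Forall2_cons hbs; apply/(hL (a1, star)).
Qed.

End Env.

(** * Agreement of the two interpretations *)

Lemma uniq_shift (xs : seq nat) : uniq xs -> uniq (rcons (map succn xs) 0).
Proof.
move=> u; rewrite rcons_uniq map_inj_uniq ?u; last exact: succn_inj.
by rewrite andbT; apply/mapP => -[].
Qed.

Lemma den_sem M n (xs : n.-tuple nat) : uniq xs ->
  forall p, den M xs p <-> sem M p.2 (env xs p.1).
Proof.
elim/term_nested_ind: M n xs => [x|M IH|M P IHM IHP|V IHV] n xs u [a alpha] /=.
- split=> [[i [beta [-> [-> ->]]]]|e]; first by rewrite env1.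
  have [/tnthP[i ex]|h] := boolP (x \in xs).
    exists i, alpha; split=> //; congr (_, _); apply: (env_inj u).
    by rewrite e env1 // ex.
  (* For [x] outside [xs] both sides are empty: [ctx1 x alpha] has a point at [x], where [env] is
     [mset0]. *)
  have /(congr1 (@^~ x)) := e; rewrite env_out // => /msetP/(_ alpha).
  by rewrite ctx1E !eqxx mset0E.
- have IHs := IH _ _ (uniq_shift u).
  split=> [[a' [b [beta [/IHs /= h [-> ->]]]]]|h].
    by rewrite coord_dcons tl_dcons -env_rcons.
  exists a, (coord alpha 0), (tl alpha); rewrite dcons_eta; split=> //.
  by apply/IHs; rewrite /= env_rcons.
- have hP : List.Forall (fun L => forall p, den L xs p <-> sem L p.2 (env xs p.1)) P.
    by apply: List.Forall_impl IHP => L; apply.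
  split=> [[a1 [a2 [b [beta [/(IHM _ _ u) /= h1 /(bag_den_sems u _ _ hP)[bs eb h2] [-> ->]]]]]]|].
    by subst b; exists bs => //; apply/(conv_env u); exists a1, a2.
  move=> [bs _ /(conv_env u)[a1 [a2 [-> h1 h2]]]].
  exists a1, a2, (seq_mset bs), alpha; split=> //; first exact/IHM.
  by apply/(bag_den_sems u _ _ hP); exists bs.
- have hV : List.Forall (fun L => forall p, den L xs p <-> sem L p.2 (env xs p.1)) V.
    by apply: List.Forall_impl IHV => L; apply.
  split=> [[b /(test_den_tests u _ hV) h [-> ->]]|[-> h]] //.
  by exists a => //; apply/(test_den_tests u _ hV).
Qed.

Lemma in_sum T (K : eqType) (S : seq K) (F : K -> set T) t :
  (\big[setU/set0]_(A <- S) F A) t <-> exists2 A, A \in S & F A t.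
Proof.
elim: S => [|B S IH]; first by rewrite big_nil; split=> [|[]].
rewrite big_cons; split=> [[h|/IH[A AS h]]|[A]].
- by exists B => //; exact: mem_head.
- by exists A => //; rewrite inE AS orbT.
- by rewrite inE => /orP[/eqP->|AS] h; [left|right; apply/IH; exists A].
Qed.

Lemma den_raw_step s n (xs : n.-tuple nat) (A : raw s) R p : uniq xs ->
  raw_step A R -> den_raw xs A p <-> exists2 B, B \in R & den_raw xs B p.
Proof.
move=> u; have [hM [hP hV]] := sem_step.
have all P : List.Forall (fun L => forall p, den L xs p <-> sem L p.2 (env xs p.1)) P.
  by apply/List.Forall_forall => L _; exact: den_sem.
case: s A R p => /= A R p.
- move=> /hM h; rewrite (den_sem _ u) h in_sum.
  by split=> -[B BR hB]; exists B => //; apply/(den_sem _ u).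
- move=> /hP h; case: p => a b; rewrite (bag_den_sems u _ _ (all A)); split.
    move=> [bs -> ]; rewrite h in_sum => -[B BR hB]; exists B => //.
    by apply/(bag_den_sems u _ _ (all B)); exists bs.
  move=> [B BR /(bag_den_sems u _ _ (all B))[bs -> hB]]; exists bs => //.
  by rewrite h in_sum; exists B.
- move=> /hV h; rewrite (test_den_tests u _ (all A)) h in_sum.
  by split=> -[B BR hB]; exists B => //; apply/(test_den_tests u _ (all B)).
Qed.

(** * Passage to equivalence classes and formal sums *)

Lemma den_repr s n (xs : n.-tuple nat) (A : raw s) :
  den_raw xs (repr (cls A)) = den_raw xs A.
Proof. by apply: den_raw_eq; apply/cls_eq; rewrite /cls reprK. Qed.

Lemma interpU s n (xs : n.-tuple nat) (A B : sums s) :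
  interp xs (A `|` B)%fset = interp xs A `|` interp xs B.
Proof.
apply/seteqP; split=> p.
- by case=> E; rewrite in_fsetU => /orP[h|h] hE; [left|right]; exists E.
- by case=> -[E h hE]; exists E => //; rewrite in_fsetU h ?orbT.
Qed.

Lemma interp_cls s n (xs : n.-tuple nat) (A : raw s) :
  interp xs [fset cls A]%fset = den_raw xs A.
Proof.
apply/seteqP; split=> p; first by move=> [_ /fset1P->]; rewrite den_repr.
by exists (cls A); rewrite ?inE ?den_repr.
Qed.

Lemma interp_to_sum s n (xs : n.-tuple nat) (R : seq (raw s)) :
  interp xs (to_sum R) = [set p | exists2 B, B \in R & den_raw xs B p].
Proof.
apply/seteqP; split=> p.
- by move=> [_ /imfsetP[B /= BR ->]]; rewrite den_repr; exists B.
- by move=> [B BR hB]; exists (cls B); rewrite ?den_repr // in_imfset.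
Qed.

Lemma interp_step s n (xs : n.-tuple nat) (A B : sums s) :
  uniq xs -> sum_step A B -> interp xs A = interp xs B.
Proof.
move=> u [M R T MR]; rewrite !interpU interp_cls interp_to_sum; congr (_ `|` _).
by apply/seteqP; split=> p /(den_raw_step p u MR).
Qed.

Theorem theorem4p12 (s : esort) (A B : sums s) (n : nat) (xs : n.-tuple nat)
    (uniq_xs : uniq xs) (fv_A : {subset fv A <= xs}) :
  reduces A B -> interp xs A = interp xs B.
Proof.
move=> {fv_A}; elim=> [C E|//|C E F _ -> _ -> //]; exact: interp_step.
Qed.
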